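(* Let $\mathcal Z=\mathbb R^{d_z}$, let $\mathcal C\subset\mathcal Z$ be a nonempty closed convex set, let $\mathbf P$ be a symmetric positive definite $d_z\times d_z$ matrix, let $n\ge1$, and let $p=\sum_{i=1}^n p_i$ and $Q=\sum_{i=1}^nQ_i$ with differentiable $p_i:\mathcal Z\to\mathbb R$ and $Q_i:\mathcal Z\to\mathcal Z$. Let $L_i,M_i\ge0$ with $L_i+M_i>0$ ($1\le i\le n$), and assume that for every $i$ the gradient $\nabla p_i$ is monotone and $L_i$-Lipschitz with respect to $\|\cdot\|_{\mathbf P}$, and the operator $Q_i$ is monotone and $M_i$-Lipschitz with respect to $\|\cdot\|_{\mathbf P}$. Let $(\alpha_t)_{t\ge0}$ be defined by $\alpha_0=1$ and $\alpha_{t+1}=2\big(1+\sqrt{1+4/\alpha_t^2}\big)^{-1}$ for $t\ge0$. Then for every $\epsilon>0$ there exist a reordering of the pairs $(p_i,Q_i)$ (with their constants $(L_i,M_i)$) and positive integers $T_1,\dots,T_n$ such that, for every $z_{\rm in}\in\mathcal C$, the output $z_{\rm out}\in\mathcal C$ of Algorithm 1 (described in the context), run on the reordered pairs with input $z_{\rm in}$, satisfies $$p(z_{\rm out})-p(z)+\langle Q(z),z_{\rm out}-z\rangle\le\epsilon\,n\,\|z_{\rm in}-z\|_{\mathbf P}^2\qquad\text{for all }z\in\mathcal C,$$ while, for each $1\le i\le n$, the algorithm performs no more than $$6^n\cdot\max\big\{\sqrt{L_i/\epsilon},\,M_i/\epsilon,\,1\big\}$$ computations of the gradient $\nabla p_i$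 and of the operator $Q_i$.
   Context: $\|z\|_{\mathbf P}=\sqrt{\langle\mathbf Pz,z\rangle}$ and $\|z\|_{\mathbf P^{-1}}=\sqrt{\langle\mathbf P^{-1}z,z\rangle}$. An operator $G:\mathbb R^d\to\mathbb R^d$ is monotone if $\langle G(x)-G(x'),x-x'\rangle\ge0$ for all $x,x'$; it is $M$-Lipschitz with respect to $\|\cdot\|_{\mathbf P}$ if $\|G(x)-G(x')\|_{\mathbf P^{-1}}\le M\|x-x'\|_{\mathbf P}$ for all $x,x'$. **Algorithm 1.** Write $t_{1:k}$ for $t_1,\dots,t_k$ (empty if $k=0$). The algorithm uses points $z^k_{s_1,\dots,s_k}\in\mathcal Z$ indexed by $k$-tuples, $1\le k\le n$, and functions $p_i^{k;t_{1:k}}:\mathcal Z\to\mathbb R$. Initialization: $z^i_{0,\dots,0}=z_{\rm in}$ ($i$ zero indices) and $p_i^{0}\equiv p_i$ for $i=1,\dots,n$. Output: $z_{\rm out}=\mathrm{Rec}(1)$. The recursive procedure $\mathrm{Rec}(k;t_{1:k-1})$ is: - If $k=n+1$: return $\arg\min_{z\in\mathcal C}\sum_{i=1}^np_i^{n;t_{1:n}}(z)$. - Otherwise set $\bar z^k_0=z^k_{t_{1:k-1},0}$ and, for $t_k=0,1,\dots,T_k-1$, do the following: 1. For $i=1,\dots,n$ set $\hat p_i^{k;t_{1:k}}(z)=\alpha_{t_k}^{-1}\,p_i^{k-1;t_{1:k-1}}\big(\alpha_{t_k}z+(1-\alpha_{t_k})\bar z^k_{t_k}\big)$ if $i\ge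 k$, and $\hat p_i^{k;t_{1:k}}(z)=p_i^{k-1;t_{1:k-1}}(z)$ if $i<k$; $L_i^{k;t_{1:k}}=L_i\prod_{l=1}^k\alpha_{t_l}$, $M_i^{k;t_{1:k}}=M_i\prod_{l=1}^k(\alpha_{t_l}/\alpha_{T_l-1})$, $H_i^{k;t_{1:k}}=L_i^{k;t_{1:k}}+M_i^{k;t_{1:k}}$; $\Delta_i^{k;t_{1:k}}=\nabla\hat p_i^{k;t_{1:k}}(z^k_{t_{1:k}})+Q_i(z^k_{t_{1:k}})$ (used, and computed, only for $i=k$); $p_k^{k;t_{1:k}}(z)=\tfrac12H_k^{k;t_{1:k}}\|z-z^k_{t_{1:k}}\|_{\mathbf P}^2+\langle z,\Delta_k^{k;t_{1:k}}\rangle$, and $p_i^{k;t_{1:k}}\equiv\hat p_i^{k;t_{1:k}}$ for $i\ne k$. 2. $z^k_{t_{1:k-1},t_k+1/2}=\mathrm{Rec}(k+1;t_{1:k})$. 3. $\bar z^k_{t_k+1}=\alpha_{t_k}z^k_{t_{1:k-1},t_k+1/2}+(1-\alpha_{t_k})\bar z^k_{t_k}$. 4. $\Delta_{Q_k}^{k;t_{1:k}}=Q_k(z^k_{t_{1:k}})-Q_k(z^k_{t_{1:k-1},t_k+1/2})$. 5. $z^k_{t_{1:k-1},t_k+1}=z^k_{t_{1:k-1},t_k+1/2}+(H_k^{k;t_{1:k}}\mathbf P)^{-1}\Delta_{Q_k}^{k;t_{1:k}}$. 6. For $l=k+1,\dots,n$: $z^l_{t_{1:k-1},t_k+1,0,\dots,0}=z^l_{t_{1:k-1},t_k,T_{k+1},0,\dots,0}$.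 After the loop return $\bar z^k_{T_k}$. Each evaluation of $\nabla\hat p_k^{k;t_{1:k}}$ at a point costs one computation of $\nabla p_k$ (at an affinely transformed point); each evaluation of $Q_k$ costs one computation of $Q_k$. *)

(* Defs.v *)
From HB Require Import structures.
From mathcomp Require Import all_boot all_order all_algebra all_fingroup.
From mathcomp Require Import all_classical all_reals all_analysis.

Set Implicit Arguments.
Unset Strict Implicit.
Unset Printing Implicit Defensive.

Import Order.TTheory GRing.Theory Num.Theory.
Import numFieldNormedType.Exports.

Local Open Scope classical_set_scope.
Local Open Scope ring_scope.

Definition dot (R : realType) (d : nat) (x y : 'cV[R]_d) : R :=
  \sum_(j < d) x j 0 * y j 0.

Definition posdef (R : realType) (d : nat) (P : 'M[R]_d) : Prop :=
  forall z : 'cV[R]_d, z != 0 -> 0 < dot (P *m z) z.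

Definition wnorm (R : realType) (d : nat) (P : 'M[R]_d) (z : 'cV[R]_d) : R :=
  Num.sqrt (dot (P *m z) z).

Definition monotone_op (R : realType) (d : nat) (G : 'cV[R]_d -> 'cV[R]_d) :
    Prop :=
  forall x x', 0 <= dot (G x - G x') (x - x').

Definition lipschitz_op (R : realType) (d : nat) (P : 'M[R]_d) (M : R)
    (G : 'cV[R]_d -> 'cV[R]_d) : Prop :=
  forall x x', wnorm (invmx P) (G x - G x') <= M * wnorm P (x - x').

Definition grad (R : realType) (d : nat) (f : 'cV[R]_d -> R) (z : 'cV[R]_d) :
    'cV[R]_d :=
  \col_j 'D_(delta_mx j 0) f z.

(* The default value 0 is used only when f has no minimizer on C. *)
Definition argmin (R : realType) (d : nat) (C : set 'cV[R]_d)
    (f : 'cV[R]_d -> R) : 'cV[R]_d :=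
  xget 0 [set z | C z /\ forall w, C w -> f z <= f w].

Fixpoint alpha (R : realType) (t : nat) : R :=
  if t is s.+1 then 2 * (1 + Num.sqrt (1 + 4 / alpha R s ^+ 2))^-1 else 1.

Section Algorithm.

Context (R : realType) (d n : nat).

(* The mutable state of a run: [points s] is the point z^k_s, the level k
   being the length of the index tuple s; [ngrad i] and [nop i] count the
   computations of the gradient of the i-th function and of the i-th operator
   made so far. *)
Record state := State {
  points : seq nat -> 'cV[R]_d;
  ngrad : 'I_n -> nat;
  nop : 'I_n -> nat }.

Definition comp (A : Type) : Type := state -> A * state.

Definition ret (A : Type) (a : A) : comp A := fun st => (a, st).

Definition bind (A B : Type) (c : comp A) (f : A -> comp B) : comp B :=
  fun st => let: (a, st') := c st in f a st'.

Local Notation "x <- c ;; e" := (bind c (fun x => e))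
  (at level 100, c at next level, right associativity).

(* f is run for the successive values 0, ..., m-1 of the loop counter. *)
Definition for_loop (A : Type) (m : nat) (f : nat -> A -> comp A) (a : A) :
    comp A :=
  iteri m (fun t c => bind c (f t)) (ret a).

Definition read (s : seq nat) : comp 'cV[R]_d := fun st => (points st s, st).

Definition write (s : seq nat) (z : 'cV[R]_d) : comp unit := fun st =>
  (tt, State (fun s' => if s' == s then z else points st s')
             (ngrad st) (nop st)).

Definition incr (k : 'I_n) (c : 'I_n -> nat) : 'I_n -> nat :=
  fun i => ((i == k) + c i)%N.

(* f is the current rescaled version of the k-th function, so evaluating its
   gradient costs one computation of the k-th gradient. *)
Definition eval_grad (k : 'I_n) (f : 'cV[R]_d -> R) (z : 'cV[R]_d) :
    comp 'cV[R]_d := fun st =>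
  (grad f z, State (points st) (incr k (ngrad st)) (nop st)).

Definition eval_op (Q : 'I_n -> 'cV[R]_d -> 'cV[R]_d) (k : 'I_n)
    (z : 'cV[R]_d) : comp 'cV[R]_d := fun st =>
  (Q k z, State (points st) (ngrad st) (incr k (nop st))).

Context (C : set 'cV[R]_d) (P : 'M[R]_d).
Context (p : 'I_n -> 'cV[R]_d -> R) (Q : 'I_n -> 'cV[R]_d -> 'cV[R]_d).
Context (L M : 'I_n -> R) (T : 'I_n -> nat).

Local Notation alpha := (alpha R).

(* H_k at the index tuple tk; levels and tuple positions are numbered from 0. *)
Definition Hcoef (k : 'I_n) (tk : seq nat) : R :=
  L k * \prod_(l < n | (l <= k)%N) alpha (nth 0%N tk l) +
  M k * \prod_(l < n | (l <= k)%N) (alpha (nth 0%N tk l) / alpha (T l).-1).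

(* The assignments z^l_(ts, t+1, 0, ..., 0) := z^l_(ts, t, T_(k+1), 0, ..., 0)
   for all levels l after k, where ks lists these levels in order: for the
   (j+1)-st of them the two tuples end with j+1, respectively j, zeros. *)
Definition warm_start (ks : seq 'I_n) (ts : seq nat) (t : nat) : comp unit :=
  if ks is k' :: _ then
    for_loop (size ks) (fun j _ =>
      z <- read (ts ++ [:: t; T k'] ++ nseq j 0%N) ;;
      write (ts ++ t.+1 :: nseq j.+1 0%N) z) tt
  else ret tt.

(* Rec(k; ts), where ks lists the levels k, ..., n in order (it is empty when
   the recursion reaches n+1) and pc i is the function p_i^{k-1; ts}. *)
Fixpoint Rec (ks : seq 'I_n) (ts : seq nat) (pc : 'I_n -> 'cV[R]_d -> R) :
    comp 'cV[R]_d :=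
  if ks is k :: ks' then
    zbar0 <- read (rcons ts 0%N) ;;
    for_loop (T k) (fun t zbar =>
      let tk := rcons ts t in
      let H := Hcoef k tk in
      let phat (i : 'I_n) (z : 'cV[R]_d) : R :=
        if (k <= i)%N then
          (alpha t)^-1 * pc i (alpha t *: z + (1 - alpha t) *: zbar)
        else pc i z in
      zt <- read tk ;;
      g <- eval_grad k (phat k) zt ;;
      q <- eval_op Q k zt ;;
      let Delta := g + q in
      let pnew (i : 'I_n) (z : 'cV[R]_d) : R :=
        if i == k then 2^-1 * H * wnorm P (z - zt) ^+ 2 + dot z Delta
        else phat i z in
      zhalf <- Rec ks' tk pnew ;;
      q0 <- eval_op Q k zt ;;
      q1 <- eval_op Q k zhalf ;;
      let DeltaQ := q0 - q1 in
      _ <- write (rcons ts t.+1) (zhalf + invmx (H *: P) *m DeltaQ) ;;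
      _ <- warm_start ks' ts t ;;
      ret (alpha t *: zhalf + (1 - alpha t) *: zbar)) zbar0
  else ret (argmin C (fun z => \sum_(i < n) pc i z)).

(* Only the points indexed by zero tuples are initialized; the default value
   of the others is never read. *)
Definition init_state (zin : 'cV[R]_d) : state :=
  State (fun s => if all (pred1 0%N) s then zin else 0)
        (fun=> 0%N) (fun=> 0%N).

Definition algorithm1 (zin : 'cV[R]_d) : 'cV[R]_d * state :=
  Rec (enum 'I_n) [::] p (init_state zin).

End Algorithm.

(* Main.v *)
(* Fix z in C and let Phi(u) be the sum of the p_i(u) - p_i(z) plus, for the
   levels already linearized, H_i/2 |u - z|^2 and, for the others,
   <Q_i(z), u - z>.  By induction on the remaining levels, a call at level k
   returns u with Phi(u) <= 1/2 sum_(i >= k) E_i (|z^i - z|^2 - |z^i' - z|^2),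
   where z^i and z^i' are the level-i points at the beginning and at the end of
   the call.  Innermost, this is strong convexity of the quadratic that is
   minimized.  At level k, the extragradient correction turns the term
   H_k/2 |u - z|^2 into a telescoping difference, convexity gives
   Phi(zbar_(t+1)) <= (1 - alpha_t) Phi(zbar_t) + alpha_t (inner bound), and
   since (1 - alpha_t) / alpha_t^2 = 1 / alpha_(t-1)^2, dividing by alpha_t^2
   makes the sum over t telescope; the warm start makes the distances of the
   deeper levels telescope as well.  At the outermost level,
   E_i = L_i W_i^2 + M_i W_i with W_i = prod_(l <= i) alpha_(T_l - 1) and
   alpha_(T-1) <= 2 / (T+1).  After sorting the pairs by
   kappa_i = max(sqrt(L_i/eps), M_i/eps, 1), each T_i is taken least such that
   prod_(l <= i) (T_l+1)/2 >= kappa_i; then prod_(l <= i) T_l <= 2^i kappa_i,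
   and each iteration costs one gradient and three operator evaluations. *)

Require Import Defs.
From HB Require Import structures.
From mathcomp Require Import all_boot all_order all_algebra all_fingroup.
From mathcomp Require Import all_classical all_reals all_analysis.
From mathcomp Require Import ring lra zify.
Import Order.TTheory GRing.Theory Num.Theory.
Import numFieldNormedType.Exports.
Local Open Scope classical_set_scope.
Local Open Scope ring_scope.

Set Implicit Arguments.
Unset Strict Implicit.
Unset Printing Implicit Defensive.

(** * Weighted norms *)

Section Dot.
Variables (R : realType) (d : nat).
Implicit Types (x y z v w : 'cV[R]_d) (a : R) (P : 'M[R]_d).

Lemma dotC x y : dot x y = dot y x.
Proof. by apply: eq_bigr => j _; rewrite mulrC. Qed.

Lemma dotDl x y z : dot (x + y) z = dot x z + dot y z.
Proof. by rewrite -big_split; apply: eq_bigr => j _; rewrite mxE mulrDl. Qed.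

Lemma dotZl a x z : dot (a *: x) z = a * dot x z.
Proof. by rewrite mulr_sumr; apply: eq_bigr => j _; rewrite mxE mulrA. Qed.

Lemma dotDr x y z : dot z (x + y) = dot z x + dot z y.
Proof. by rewrite dotC dotDl !(dotC z). Qed.

Lemma dotZr a x z : dot z (a *: x) = a * dot z x.
Proof. by rewrite dotC dotZl dotC. Qed.

Lemma dotNl x z : dot (- x) z = - dot x z.
Proof. by rewrite -scaleN1r dotZl mulN1r. Qed.

Lemma dotNr x z : dot z (- x) = - dot z x.
Proof. by rewrite dotC dotNl dotC. Qed.

Lemma dot0l z : dot 0 z = 0.
Proof. by rewrite -(scale0r 0) dotZl mul0r. Qed.

Lemma dot0r z : dot z 0 = 0.
Proof. by rewrite dotC dot0l. Qed.

Definition dotE := (dotDl, dotDr, dotNl, dotNr, dotZl, dotZr).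

Lemma dot_suml n (F : 'I_n -> 'cV[R]_d) z :
  dot (\sum_i F i) z = \sum_i dot (F i) z.
Proof. by elim/big_ind2: _ => [|x1 r1 x2 r2 <- <-|//]; rewrite ?dot0l ?dotDl. Qed.

Lemma dot_sumr n (F : 'I_n -> 'cV[R]_d) z :
  dot z (\sum_i F i) = \sum_i dot z (F i).
Proof. by rewrite dotC dot_suml; apply: eq_bigr => i _; rewrite dotC. Qed.

Lemma dot_delta x j : dot x (delta_mx j 0) = x j 0.
Proof.
rewrite /dot (bigD1 j)//= mxE !eqxx mulr1 big1 ?addr0// => i ij.
by rewrite mxE (negbTE ij) mulr0.
Qed.

Lemma dotE_mul x y : dot x y = (x^T *m y) 0 0.
Proof. by rewrite mxE; apply: eq_bigr => j _; rewrite mxE. Qed.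

Lemma dot_mulmxl P x y : dot (P *m x) y = dot x (P^T *m y).
Proof. by rewrite !dotE_mul trmx_mul mulmxA. Qed.

End Dot.

Section WeightedNorm.
Variables (R : realType) (d : nat) (P : 'M[R]_d).
Hypotheses (Psym : P^T = P) (Ppos : posdef P).
Implicit Types (x y z v w : 'cV[R]_d) (a : R).

Lemma dot_sym x y : dot (P *m x) y = dot (P *m y) x.
Proof. by rewrite dot_mulmxl Psym dotC. Qed.

Lemma dot_ge0 z : 0 <= dot (P *m z) z.
Proof.
by have [->|/Ppos/ltW//] := eqVneq z 0; rewrite mulmx0 dot0l.
Qed.

Lemma wnorm_ge0 z : 0 <= wnorm P z.
Proof. exact: sqrtr_ge0. Qed.

Lemma wnorm_sqr z : wnorm P z ^+ 2 = dot (P *m z) z.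
Proof. by rewrite sqr_sqrtr// dot_ge0. Qed.

(** A vector in the kernel pairs to zero with its image, so definiteness forces it to vanish;
    symmetry lets the row kernel be read as column vectors. *)
Lemma posdef_unitmx : P \in unitmx.
Proof.
rewrite -row_free_unit; apply/row_freeP.
have k0 : kermx P = 0.
  apply/row_matrixP => i; rewrite row0; apply/eqP; apply: contraT => ri0.
  have := @Ppos (row i (kermx P))^T.
  rewrite -(inj_eq (@trmx_inj _ _ _)) trmxK trmx0 => /(_ ri0).
  rewrite -[in X in X *m _]Psym -trmx_mul -row_mul mulmx_ker row0 trmx0.
  by rewrite dot0l ltxx.
by exists (pinvmx P); apply: mulmxVp; rewrite -kermx_eq0 k0.
Qed.

Lemma mulmxKV x : P *m (invmx P *m x) = x.
Proof. by rewrite mulmxA mulmxV ?mul1mx// posdef_unitmx. Qed.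

(** The dual norm of [x] is the primal norm of [invmx P *m x], so its square is nonnegative by the
    definiteness of [P] itself. *)
Lemma wnorm_inv_sqr x :
  wnorm (invmx P) x ^+ 2 = dot (P *m (invmx P *m x)) (invmx P *m x).
Proof.
have e : dot (P *m (invmx P *m x)) (invmx P *m x) = dot (invmx P *m x) x.
  by rewrite mulmxKV dotC.
by rewrite sqr_sqrtr -e// dot_ge0.
Qed.

(** Write [x = P u], let [r] and [s] be the norms of [u] and [y], expand the square of [s u - r y]
    and divide by [s r]. *)
Lemma cauchy_schwarz x y : dot x y <= wnorm (invmx P) x * wnorm P y.
Proof.
rewrite -[X in dot X]mulmxKV.
have := wnorm_inv_sqr x; have := sqrtr_ge0 (dot (invmx P *m x) x).
rewrite -/(wnorm (invmx P) x).
move: (invmx P *m x) (wnorm _ x) => u r r0 ru.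
have := wnorm_ge0 y; have := wnorm_sqr y; move: (wnorm P y) => s sy s0.
have := dot_ge0 (s *: u - r *: y).
rewrite mulmxBr -!scalemxAr !dotE -ru -sy (dot_sym y u) => h.
have {}h : s * r * dot (P *m u) y <= (s * r) * (r * s) by lra.
have [sr0|] := ltP 0 (s * r); first by rewrite ler_pM2l// in h.
(* Division is impossible here, but one of the two vectors has norm zero and hence vanishes. *)
move=> sr0; have {sr0} : s * r = 0 by apply/eqP; rewrite eq_le sr0 mulr_ge0.
move/eqP; rewrite mulf_eq0 => /orP[/eqP s0'|/eqP r0'].
- rewrite s0' in sy *; move/eqP: sy; rewrite expr0n/= eq_sym => /eqP sy.
  suff -> : y = 0 by rewrite dot0r mulr0.
  by apply/eqP; apply: contraT => /Ppos; rewrite sy ltxx.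
- rewrite r0' in ru *; move/eqP: ru; rewrite expr0n/= eq_sym => /eqP ru.
  suff -> : u = 0 by rewrite mulmx0 dot0l mul0r.
  by apply/eqP; apply: contraT => /Ppos; rewrite ru ltxx.
Qed.

Lemma wnormN z : wnorm P (- z) = wnorm P z.
Proof. by rewrite /wnorm mulmxN dotNl dotNr opprK. Qed.

Lemma wnormZ a z : wnorm P (a *: z) = `|a| * wnorm P z.
Proof.
by rewrite /wnorm -scalemxAr !dotE mulrA -expr2 sqrtrM ?sqr_ge0// sqrtr_sqr.
Qed.

Lemma wnormB x y : wnorm P (x - y) = wnorm P (y - x).
Proof. by rewrite -wnormN opprB. Qed.

(* Stewart's identity, the exact form of strong convexity of the norm. *)
Lemma wnorm_conv a x y z :
  wnorm P (a *: x + (1 - a) *: y - z) ^+ 2 =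
  a * wnorm P (x - z) ^+ 2 + (1 - a) * wnorm P (y - z) ^+ 2
  - a * (1 - a) * wnorm P (x - y) ^+ 2.
Proof.
rewrite !wnorm_sqr !(mulmxBr, mulmxDr) -!scalemxAr !dotE.
by rewrite (dot_sym y x) (dot_sym z x) (dot_sym z y); ring.
Qed.

Lemma wnorm_addZ a x y : wnorm P (x + a *: y) ^+ 2 =
  wnorm P x ^+ 2 + 2 * a * dot (P *m y) x + a ^+ 2 * dot (P *m y) y.
Proof.
rewrite !wnorm_sqr mulmxDr -scalemxAr !dotE (dot_sym x y); ring.
Qed.

(** Each coordinate is a pairing with a basis vector, so Cauchy-Schwarz applies. This makes sublevel
    sets bounded in the sup norm. *)
Lemma wnorm_coord_bound : exists c : R, forall z j, `|z j 0| <= c * wnorm P z.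
Proof.
exists (\sum_(j < d) wnorm (invmx P) (delta_mx j 0)) => z j.
have le_sum : wnorm (invmx P) (delta_mx j 0) <=
    \sum_(j < d) wnorm (invmx P) (delta_mx j 0).
  by rewrite [leRHS](bigD1 j)//= lerDl sumr_ge0// => i _; exact: sqrtr_ge0.
rewrite ler_norml; apply/andP; split; last first.
  rewrite -dot_delta dotC; apply: (le_trans (cauchy_schwarz _ _)).
  by rewrite ler_wpM2r ?wnorm_ge0.
rewrite lerNl -dot_delta -dotNl dotC; apply: (le_trans (cauchy_schwarz _ _)).
by rewrite wnormN ler_wpM2r ?wnorm_ge0.
Qed.

End WeightedNorm.

(** * Smooth convex functions *)

Section Smooth.
Variables (R : realType) (d : nat).
Implicit Types (f : 'cV[R]_d -> R) (x y z v b : 'cV[R]_d) (a K : R).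

Lemma dot_grad f x v : differentiable f x -> dot (grad f x) v = 'D_v f x.
Proof.
move=> df; rewrite deriveE// [in RHS](matrix_sum_delta v) exchange_big/= big_ord1.
rewrite linear_sum/=; apply: eq_bigr => j _.
by rewrite linearZ/= mxE -deriveE// mulrC.
Qed.

Lemma is_derive_line f x v (t : R) : differentiable f (x + t *: v) ->
  is_derive t 1 (fun s : R => f (x + s *: v)) (dot (grad f (x + t *: v)) v).
Proof.
move=> df.
have e : (fun h : R => h^-1 *: (((fun s : R => f (x + s *: v)) \o shift t) (h *: 1)
           - f (x + t *: v))) =
         (fun h => h^-1 *: ((f \o shift (x + t *: v)) (h *: v) - f (x + t *: v))).
  apply/funext => h /=; congr (_ *: (f _ - _)).
  by rewrite scalerDl /GRing.scale/= mulr1 addrCA.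
apply: DeriveDef; rewrite /derivable /derive e; first exact: diff_derivable.
by rewrite dot_grad.
Qed.

(** Mean value theorem for [g] minus its quadratic majorant, whose derivative is nonpositive on the
    unit interval. *)
Lemma taylor1_le (g dg : R -> R) (B : R) :
  (forall t : R, is_derive t 1 g (dg t)) ->
  (forall t : R, 0 <= t <= 1 -> dg t - dg 0 <= B * t) -> g 1 - g 0 - dg 0 <= B / 2.
Proof.
move=> der dgB.
pose h (t : R) := g t - (dg 0 * t + B / 2 * t ^+ 2).
have derh (t : R) : is_derive t 1 h (dg t - (dg 0 + B * t)).
  have := der t => dert.
  apply: is_derive_eq.
  by rewrite /GRing.scale/=; lra.
have [|t] := @MVT_segment R h _ 0 1 ler01 (fun t _ => derh t).
  apply: continuous_subspaceT => t.
  apply: differentiable_continuous; apply/derivable1_diffP.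
  by case: (derh t).
rewrite in_itv/= => t01 e; have := dgB _ t01; move: e; rewrite /h; lra.
Qed.

(** Two-sided bound on the Bregman divergence: convexity on the left, the descent lemma on the
    right. *)
Definition convex_smooth (P : 'M[R]_d) K f :=
  (forall z, differentiable f z) /\
  (forall x y, 0 <= f y - f x - dot (grad f x) (y - x) <=
     K / 2 * wnorm P (y - x) ^+ 2).


(** On the segment from [x] to [y], monotonicity bounds the increment of the derivative below by
    zero and the Lipschitz condition bounds it above linearly; [taylor1_le] is applied to [g] and to
    [- g]. *)
Lemma lipschitz_convex_smooth (P : 'M[R]_d) K f :
  P^T = P -> posdef P -> (forall z, differentiable f z) ->
  monotone_op (grad f) -> lipschitz_op P K (grad f) -> convex_smooth P K f.
Proof.
move=> Psym Ppos df mono lip; split=> // x y.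
have der (t : R) := @is_derive_line f x (y - x) t (df _).
set g := fun _ => _ in der.
set dg := fun t : R => dot (grad f (x + t *: (y - x))) (y - x).
have dgE (t : R) : 0 <= t <= 1 -> 0 <= dg t - dg 0 <= K * wnorm P (y - x) ^+ 2 * t.
  move=> /andP[t0 t1]; rewrite /dg scale0r addr0 -dotNl -dotDl; apply/andP; split.
    move: t0; rewrite le_eqVlt => /orP[/eqP<-|t0].
      by rewrite scale0r addr0 subrr dot0l.
    have := mono (x + t *: (y - x)) x; rewrite addrAC subrr add0r dotZr.
    by rewrite pmulr_rge0.
  apply: (le_trans (cauchy_schwarz Psym Ppos _ _)).
  have := lip (x + t *: (y - x)) x; rewrite addrAC subrr add0r => h.
  apply: (le_trans (ler_wpM2r (wnorm_ge0 _ _) h)).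
  rewrite -(ger0_norm t0) wnormZ// normr_id; lra.
have hi : g 1 - g 0 - dg 0 <= K * wnorm P (y - x) ^+ 2 / 2.
  by apply: (taylor1_le der) => t /dgE/andP[].
have derN (t : R) : is_derive t 1 (fun t => - g t) (- dg t).
  by have := der t => dert; apply: is_derive_eq.
have lo : - g 1 - - g 0 - - dg 0 <= 0 / 2.
  apply: (taylor1_le derN) => t /dgE/andP[+ _]; lra.
have g1 : g 1 = f y by rewrite /g scale1r addrC subrK.
have g0 : g 0 = f x by rewrite /g scale0r addr0.
have dg0 : dg 0 = dot (grad f x) (y - x) by rewrite /dg scale0r addr0.
rewrite -g1 -g0 -dg0; move: lo hi; rewrite mul0r.
move: (g 1) (g 0) (dg 0) => a b c lo hi.
by apply/andP; split; lra.
Qed.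

Lemma grad_rescale f a b z : a != 0 -> differentiable f (a *: z + b) ->
  grad (fun z => a^-1 * f (a *: z + b)) z = grad f (a *: z + b).
Proof.
move=> a0 df; apply/matrixP => j k; rewrite !mxE.
set v := delta_mx j 0.
transitivity ('D_v f (a *: z + b)) => //.
have -> : 'D_v f (a *: z + b) = a^-1 * 'D_(a *: v) f (a *: z + b).
  by rewrite !deriveE// linearZ/= mulKf.
rewrite /derive; set g := fun h : R => _; set k' := fun h : R => _.
have -> : g = a^-1 *: k'.
  apply/funext => h; rewrite /g /k' /= !fctE/=.
  have -> : a *: (h *: v + z) + b = h *: (a *: v) + (a *: z + b).
    by rewrite scalerDr !scalerA (mulrC a h) addrA.
  by rewrite /GRing.scale/= -mulrBr mulrCA.
by rewrite limZl_tmp//; exact: diff_derivable.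
Qed.

(** Displacements shrink by [a], so the quadratic bound gains [a ^ 2], of which the outer factor
    [a^-1] leaves [a]. *)
Lemma convex_smooth_rescale (P : 'M[R]_d) K f a b : 0 < a ->
  convex_smooth P K f ->
  convex_smooth P (K * a) (fun z => a^-1 * f (a *: z + b)).
Proof.
move=> a0 [df fK]; split=> [z|x y].
  apply: (@differentiableZ _ _ _ (fun z => f (a *: z + b))).
  apply: (@differentiable_comp _ _ _ _ (fun z => a *: z + b)) => //.
rewrite grad_rescale ?gt_eqF//.
have := fK (a *: x + b) (a *: y + b).
rewrite opprD addrACA subrr addr0 -scalerBr dotZr wnormZ exprMn (ger0_norm (ltW a0)).
set fy := f _; set fx := f _; set D := dot _ _; set N := wnorm _ _ ^+ 2.
have -> : a^-1 * fy - a^-1 * fx - D = a^-1 * (fy - fx - a * D).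
  by field; rewrite gt_eqF.
have -> : K * a / 2 * N = a^-1 * (K / 2 * (a ^+ 2 * N)) by field; rewrite gt_eqF.
move=> /andP[h1 h2]; rewrite pmulr_rge0 ?invr_gt0// h1/=.
by rewrite ler_wpM2l // invr_ge0 ltW.
Qed.

End Smooth.

(** * Minimization of strongly convex quadratics *)

Section Quadratic.
Variables (R : realType) (d : nat) (P : 'M[R]_d).
Hypotheses (Psym : P^T = P) (Ppos : posdef P).
Implicit Types (f : 'cV[R]_d -> R) (x y z u D : 'cV[R]_d) (a H e : R).
Implicit Types (C : set 'cV[R]_d).

Definition quadratic H f := exists D e,
  forall z, f z = H / 2 * wnorm P z ^+ 2 + dot z D + e.

Lemma quadratic_model H x D :
  quadratic H (fun z => 2^-1 * H * wnorm P (z - x) ^+ 2 + dot z D).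
Proof.
exists (D - H *: (P *m x)), (H / 2 * wnorm P x ^+ 2) => z.
rewrite !wnorm_sqr// mulmxBr !dotE (dot_sym Psym x z) (dotC z (P *m x)).
by rewrite (dot_sym Psym x z); field.
Qed.

Lemma quadratic_sum n (H : 'I_n -> R) (F : 'I_n -> 'cV[R]_d -> R) :
  (forall i, quadratic (H i) (F i)) ->
  quadratic (\sum_i H i) (fun z => \sum_i F i z).
Proof.
move=> /choice[D /choice[e FE]].
exists (\sum_i D i), (\sum_i e i) => z.
rewrite (eq_bigr _ (fun i _ => FE i z)) !big_split/= dot_sumr.
by rewrite -!mulr_suml.
Qed.

Lemma quadratic_conv H f a x y : quadratic H f ->
  f (a *: x + (1 - a) *: y) =
  a * f x + (1 - a) * f y - H / 2 * (a * (1 - a) * wnorm P (x - y) ^+ 2).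
Proof.
move=> [D [e fE]]; rewrite !fE.
have := wnorm_conv Psym Ppos a x y 0; rewrite !subr0 => ->.
by rewrite !dotE; ring.
Qed.

Lemma cvg_rsum (T : topologicalType) n (v : T) (F : 'I_n -> T -> R) :
  (forall i, F i @ v --> F i v) ->
  \sum_(i < n) F i w @[w --> v] --> \sum_(i < n) F i v.
Proof.
move=> cF; apply: (@cvg_big _ _ +%R 0 xpredT _ _ (nbhs v)) => //.
exact: (@add_continuous R).
Qed.

Lemma quadratic_comp_continuous (T : topologicalType) (g : T -> 'cV[R]_d) H f :
  (forall j, continuous (fun v => g v j 0)) -> quadratic H f ->
  continuous (f \o g).
Proof.
move=> cg [D [e fE]].
have -> : f \o g = (fun v =>
    H / 2 * (\sum_(j < d) (\sum_(k < d) P j k * g v k 0) * g v j 0)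
    + \sum_(j < d) g v j 0 * D j 0 + e).
  apply/funext => v; rewrite /= fE wnorm_sqr//; congr (_ * _ + _ + _).
  by apply: eq_bigr => j _; rewrite !mxE.
move=> v; apply: cvgD; last exact: cvg_cst.
apply: cvgD.
  apply: cvgM; first exact: cvg_cst.
  apply: cvg_rsum => j; apply: cvgM; last exact: cg.
  by apply: cvg_rsum => k; apply: cvgM; [exact: cvg_cst|exact: cg].
by apply: cvg_rsum => j; apply: cvgM; [exact: cg|exact: cvg_cst].
Qed.

(** Young's inequality absorbs the linear term into half of the quadratic one; [r <= 1 + r ^ 2] then
    avoids a square root. *)
Lemma quadratic_coercive H f b : 0 < H -> quadratic H f ->
  exists r : R, forall z, f z <= b -> wnorm P z <= r.
Proof.
move=> H0 [D [e fE]].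
set q := wnorm (invmx P) (- D).
exists (1 + 4 / H * (b - e + q ^+ 2 / H)) => z; rewrite fE.
have := cauchy_schwarz Psym Ppos (- D) z; rewrite -/q dotNl (dotC D z).
move: (wnorm P z) (dot z D) => r s h1 h2.
have h3 : q * r <= H / 4 * r ^+ 2 + q ^+ 2 / H.
  rewrite -subr_ge0 (_ : _ - _ = (H * r - 2 * q) ^+ 2 / (4 * H)).
    by rewrite divr_ge0 ?sqr_ge0// mulr_ge0// ltW.
  by field; rewrite gt_eqF.
have h4 : H / 4 * r ^+ 2 <= b - e + q ^+ 2 / H by lra.
have h5 : r ^+ 2 <= 4 / H * (b - e + q ^+ 2 / H).
  rewrite [leLHS](_ : _ = 4 / H * (H / 4 * r ^+ 2)); last by field; rewrite gt_eqF.
  by rewrite ler_wpM2l// divr_ge0// ltW.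
by have := sqr_ge0 (r - 1); have := sqr_ge0 r; nra.
Qed.

Lemma quadratic_min_exists C H f : 0 < H -> quadratic H f ->
  C !=set0 -> closed C -> exists2 u, C u & forall w, C w -> f u <= f w.
Proof.
move=> H0 qf [c0 Cc0] clC.
have [r fr] := quadratic_coercive (f c0) H0 qf.
have [K coordK] := wnorm_coord_bound Psym Ppos.
(* The sublevel set of a feasible value, transposed because compactness is argued on row vectors. *)
pose A : set 'rV[R]_d := [set v | C v^T] `&` [set v | f v^T <= f c0].
have contT : continuous (fun v : 'rV[R]_d => v^T : 'cV[R]_d).
  move=> v X /nbhs_ballP[e /= e0 eX]; apply/nbhs_ballP; exists e => //= w [_ vw].
  by apply: eX; split=> // i j; rewrite !mxE; exact: vw.
have contf : continuous (f \o (fun v : 'rV[R]_d => v^T)).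
  apply: (quadratic_comp_continuous _ qf) => j.
  have -> : (fun v : 'rV[R]_d => v^T j 0) = (fun v => v 0 j).
    by apply/funext => w; rewrite mxE.
  exact: coord_continuous.
have clA : closed A.
  apply: closedI; first by apply: (closed_comp (fun v _ => contT v)).
  apply: (@closed_comp _ _ (fun v : 'rV[R]_d => f v^T) [set s | s <= f c0]).
    by move=> v _; exact: contf.
  exact: closed_le.
have bdA : bounded_set A.
  exists (`|K| * `|r|); split; first exact: num_real.
  move=> s ltKs v [_ /= /fr vr]; rewrite [leLHS]/Num.norm/= mx_normrE.
  apply/bigmax_leP; split=> [|[i j] _ /=].
    by rewrite (le_trans _ (ltW ltKs))// mulr_ge0.
  rewrite ord1; apply: le_trans (ltW ltKs).
  have := coordK v^T j; rewrite mxE => /le_trans; apply.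
  apply: (le_trans (ler_norm _)); rewrite normrM ler_wpM2l//.
  by rewrite ger0_norm ?wnorm_ge0// (le_trans vr)// ler_norm.
have A0 : A !=set0 by exists c0^T; rewrite /A/= trmxK.
have [v vA vmin] := compact_EVT_min A0 (bounded_closed_compact bdA clA)
  (continuous_subspaceT contf).
have [Cv fv] : A v by exact/set_mem.
exists v^T => // w Cw; have [fw|/ltW] := leP (f w) (f c0).
  by rewrite -[w]trmxK; apply: vmin; apply/mem_set; rewrite /A/= trmxK.
exact: le_trans.
Qed.

(** The minimizer is compared with points of the segment towards [w] at parameter [a]; the quadratic
    gain is recovered as [a] tends to zero. *)
Lemma quadratic_argmin C H f : 0 < H -> quadratic H f ->
  C !=set0 -> closed C -> convex_set C ->
  C (argmin C f) /\ forall w, C w ->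
    f (argmin C f) + H / 2 * wnorm P (argmin C f - w) ^+ 2 <= f w.
Proof.
move=> H0 qf C0 clC cvC.
have [u0 Cu0 u0min] := quadratic_min_exists H0 qf C0 clC.
have [Cu umin] : [set z | C z /\ forall w, C w -> f z <= f w] (argmin C f).
  by apply: (xgetPex 0); exists u0.
split=> // w Cw; move: (argmin C f) Cu umin => u Cu umin.
set N := wnorm _ _ ^+ 2.
have main a : 0 < a -> a < 1 -> (1 - a) * (H / 2 * N) <= f w - f u.
  move=> a0 a1; have a01 : 0 <= a <= 1 by rewrite !ltW.
  have /umin : C (a *: w + (1 - a) *: u).
    have := cvC w u (Itv01 (ltW a0) (ltW a1)).
    by rewrite !inE; apply.
  rewrite (quadratic_conv _ _ _ qf) (wnormB P w u) -/N => h.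
  rewrite -(ler_pM2l a0); lra.
rewrite -lerBrDl; apply/ler_addgt0Pr => e e0.
set B := H / 2 * N.
have B0 : 0 <= B by rewrite mulr_ge0 ?sqr_ge0// divr_ge0// ltW.
(* This parameter lies strictly between 0 and 1, and its product with [B] is at most [e]. *)
have := main (e / (e + B + B + 1)); rewrite -/B.
have s0 : 0 < e + B + B + 1 by lra.
rewrite divr_gt0// ltr_pdivrMr// mul1r => /(_ isT) h.
have : e < e + B + B + 1 by lra.
move=> /h {}h; apply: (@le_trans _ _ (f w - f u + e / (e + B + B + 1) * B)).
  by move: h; lra.
rewrite lerD2l mulrAC ler_pdivrMr// ler_pM2l//; lra.
Qed.

End Quadratic.

(** * The step sizes *)

Section Alpha.
Variable R : realType.
Local Notation alpha := (alpha R).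

Lemma alpha_gt0 t : 0 < alpha t.
Proof.
by case: t => [|t] //=; rewrite mulr_gt0// invr_gt0 ltr_wpDr// sqrtr_ge0.
Qed.

Lemma alphaS_inv t : (alpha t.+1)^-1 =
  (1 + Num.sqrt (1 + 4 * (alpha t)^-1 ^+ 2)) / 2.
Proof. by rewrite /= invfM invrK exprVn mulrC. Qed.

(* In terms of [b = 1 / alpha], the recursion reads [b' ^ 2 - b' = b ^ 2]. *)
Lemma alphaS_rec t : (1 - alpha t.+1) / alpha t.+1 ^+ 2 = (alpha t)^-1 ^+ 2.
Proof.
have -> : (1 - alpha t.+1) / alpha t.+1 ^+ 2 =
    (alpha t.+1)^-1 ^+ 2 - (alpha t.+1)^-1.
  by field; rewrite gt_eqF// alpha_gt0.
rewrite alphaS_inv; set s := Num.sqrt _.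
have ss : s ^+ 2 = 1 + 4 * (alpha t)^-1 ^+ 2.
  by rewrite sqr_sqrtr// addr_ge0// mulr_ge0// sqr_ge0.
have -> : (alpha t)^-1 ^+ 2 = (s ^+ 2 - 1) / 4 by rewrite ss; lra.
by field.
Qed.

(** With [b = 1 / alpha t], the square root in the recursion is at least [2 b]. *)
Lemma alphaS_inv_ge t : (alpha t)^-1 + 2^-1 <= (alpha t.+1)^-1.
Proof.
have b0 : 0 <= (alpha t)^-1 by rewrite invr_ge0 ltW// alpha_gt0.
rewrite alphaS_inv; move: (_^-1) b0 => b b0.
have : Num.sqrt ((2 * b) ^+ 2) <= Num.sqrt (1 + 4 * b ^+ 2).
  by rewrite ler_wsqrtr// exprMn; lra.
rewrite sqrtr_sqr ger0_norm ?mulr_ge0//; lra.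
Qed.

Lemma alpha_inv_ge t : t%:R / 2 + 1 <= (alpha t)^-1.
Proof.
elim: t => [|t IHt]; first by rewrite mul0r add0r invr1.
by have := alphaS_inv_ge t; rewrite -[t.+1%:R]natr1; lra.
Qed.

Lemma alphaS_le t : alpha t.+1 <= alpha t.
Proof.
rewrite -lef_pV2 ?posrE ?alpha_gt0//; have := alphaS_inv_ge t; lra.
Qed.

Lemma alpha_le s t : (s <= t)%N -> alpha t <= alpha s.
Proof.
move=> /subnK <-; elim: (t - s)%N => // u; apply: le_trans; exact: alphaS_le.
Qed.

Lemma alpha_le1 t : alpha t <= 1.
Proof. exact: (alpha_le (leq0n t)). Qed.

End Alpha.

(** * One iteration *)

Section OneStep.
Variables (R : realType) (d : nat) (P : 'M[R]_d).
Hypotheses (Psym : P^T = P) (Ppos : posdef P).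
Implicit Types (f : 'cV[R]_d -> R) (z u q : 'cV[R]_d) (a H K M : R).

(** Average the gradient inequalities at the combination [w]; their linear terms cancel. *)
Lemma convex_smooth_conv K f a x y : 0 <= a <= 1 -> convex_smooth P K f ->
  f (a *: x + (1 - a) *: y) <= a * f x + (1 - a) * f y.
Proof.
move=> /andP[a0 a1] [_ fK]; set w := _ + _.
have /andP[hx _] := fK w x; have /andP[hy _] := fK w y.
have hx' := mulr_ge0 a0 hx.
have a1' : 0 <= 1 - a by rewrite subr_ge0.
have hy' := mulr_ge0 a1' hy.
have dw : a * dot (grad f w) (x - w) + (1 - a) * dot (grad f w) (y - w) = 0.
  rewrite -!dotZr -dotDr; set v := (X in dot _ X).
  suff -> : v = 0 by rewrite dot0r.
  rewrite /v !scalerBr addrACA -/w -opprD -scalerDl addrCA subrr addr0 scale1r.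
  by rewrite subrr.
lra.
Qed.

(** Handles the levels already linearized, which are not rescaled. Stewart's identity for [f] and
    for the distance gives two nonpositive remainders. *)
Lemma quadratic_step H f a zh zb z : 0 <= a <= 1 -> 0 <= H -> quadratic P H f ->
  let zb' := a *: zh + (1 - a) *: zb in
  f zb' - f z + H / 2 * wnorm P (zb' - z) ^+ 2 <=
  (1 - a) * (f zb - f z + H / 2 * wnorm P (zb - z) ^+ 2) +
  a * (f zh - f z + H / 2 * wnorm P (zh - z) ^+ 2).
Proof.
move=> /andP[a0 a1] H0 qf /=.
rewrite (quadratic_conv Psym Ppos _ _ _ qf) wnorm_conv//.
have : 0 <= H * (a * (1 - a) * wnorm P (zh - zb) ^+ 2).
  by rewrite mulr_ge0// mulr_ge0 ?sqr_ge0// mulr_ge0// subr_ge0.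
lra.
Qed.

(** Handles the rescaled levels: [a * fa zh] is exactly [f zb'], convexity bounds [a * fa z] from
    above, and the operator term is affine. *)
Lemma rescale_step K f q a zh zb z : 0 < a <= 1 -> convex_smooth P K f ->
  let zb' := a *: zh + (1 - a) *: zb in
  let fa u := a^-1 * f (a *: u + (1 - a) *: zb) in
  f zb' - f z + dot q (zb' - z) <=
  (1 - a) * (f zb - f z + dot q (zb - z)) +
  a * (fa zh - fa z + dot q (zh - z)).
Proof.
move=> /andP[a0 a1] fK /=.
have := @convex_smooth_conv K f a z zb; rewrite ltW// a1 => /(_ isT fK).
set fb := f (a *: zh + _); set fz := f (a *: z + _) => h.
have -> : a * (a^-1 * fb - a^-1 * fz + dot q (zh - z)) =
  fb - fz + a * dot q (zh - z) by field; rewrite gt_eqF.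
rewrite !dotE; lra.
Qed.

(* The correction [invmx (H *: P) *m (Q zt - Q zh)] turns the cross term of the
   frozen operator into a telescoping difference of squared distances; the
   leftover [L + M ^ 2 / H - H] is nonpositive by the choice of [H]. *)
Lemma extragradient_step f Q L M H zt zh zn z :
  convex_smooth P L f -> monotone_op Q -> lipschitz_op P M Q ->
  0 <= M -> M <= H - L -> M <= H -> 0 < H ->
  zn = zh + invmx (H *: P) *m (Q zt - Q zh) ->
  f zh - f z + dot (Q z) (zh - z) <=
  2^-1 * H * wnorm P (zh - zt) ^+ 2 + dot zh (grad f zt + Q zt)
  - (2^-1 * H * wnorm P (z - zt) ^+ 2 + dot z (grad f zt + Q zt))
  + H / 2 * wnorm P (zh - z) ^+ 2
  + H / 2 * (wnorm P (zt - z) ^+ 2 - wnorm P (zn - z) ^+ 2).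
Proof.
move=> [_ fL] monoQ lipQ M0 MHL MH' H0 znE'.
have Pu := posdef_unitmx Psym Ppos.
set dq := Q zt - Q zh; set w := invmx P *m dq.
have znE : zn - z = (zh - z) + H^-1 *: w.
  rewrite znE' invmxZ ?unitmxZ ?unitfE ?gt_eqF// -scalemxAl -/w.
  by rewrite addrAC.
have Pw : P *m w = dq by rewrite /w mulmxKV.
have Nw : dot dq w <= M ^+ 2 * wnorm P (zt - zh) ^+ 2.
  rewrite -{1}Pw -(wnorm_inv_sqr Psym Ppos) -exprMn.
  by apply: lerXn2r => //; [exact: sqrtr_ge0|exact/mulr_ge0/sqrtr_ge0|exact: lipQ].
have MH : M ^+ 2 <= H * (H - L).
  by rewrite expr2; apply: ler_pM.
(* The linearization at [zt] bounds [f zh] above by smoothness and [f z] below by convexity. *)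
have /andP[_ f1] := fL zt zh; have /andP[f2 _] := fL zt z.
have mQ := monoQ zh z.
have e : wnorm P (zn - z) ^+ 2 = wnorm P (zh - z) ^+ 2
    + 2 * H^-1 * dot dq (zh - z) + H^-1 ^+ 2 * dot dq w.
  by rewrite znE wnorm_addZ// Pw.
have h : H / 2 * (H^-1 ^+ 2 * dot dq w) <= (H - L) / 2 * wnorm P (zt - zh) ^+ 2.
  rewrite [leLHS](_ : _ = dot dq w / (2 * H)); last by field; rewrite gt_eqF.
  rewrite ler_pdivrMr ?mulr_gt0//; apply: (le_trans Nw).
  have := ler_wpM2r (sqr_ge0 (wnorm P (zt - zh))) MH; lra.
rewrite e; have -> : H / 2 * (wnorm P (zt - z) ^+ 2 - (wnorm P (zh - z) ^+ 2
    + 2 * H^-1 * dot dq (zh - z) + H^-1 ^+ 2 * dot dq w)) =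
    H / 2 * wnorm P (zt - z) ^+ 2 - H / 2 * wnorm P (zh - z) ^+ 2
    - dot dq (zh - z) - H / 2 * (H^-1 ^+ 2 * dot dq w).
  by field; rewrite gt_eqF.
move: f1 f2 mQ h; rewrite /dq (wnormB P zt z) (wnormB P zt zh).
rewrite (dotC zh) (dotC z) !dotE; lra.
Qed.

End OneStep.

(** * Loops and warm starts *)

Section ForLoop.
Variables (R : realType) (d n : nat).
Local Notation state := (state R d n).

Lemma for_loop_ind (A : Type) (I : nat -> A -> state -> Prop)
    (m : nat) (f : nat -> A -> Defs.comp R d n A) (a : A) (st : state) :
  I 0%N a st ->
  (forall t x s, (t < m)%N -> I t x s -> I t.+1 (f t x s).1 (f t x s).2) ->
  I m (for_loop m f a st).1 (for_loop m f a st).2.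
Proof.
move=> I0 IS; rewrite /for_loop.
suff : forall t, (t <= m)%N ->
  let r := iteri t (fun t c => bind c (f t)) (ret a) st in I t r.1 r.2.
  exact.
elim=> [|t IHt] // tm; have {IHt} := IHt (ltnW tm).
rewrite /bind /=; case: (iteri _ _ _ _) => x s /= /IS; exact.
Qed.

Variables (T : 'I_n -> nat).

(* Extends [T] by junk beyond the last level, where it is never used. *)
Definition Tnat (k : nat) : nat := oapp T 0%N (insub k).

Lemma Tnat_ord (k : 'I_n) : Tnat k = T k.
Proof. by rewrite /Tnat valK. Qed.

(** The copies do not interfere: tuples read carry [t] after [ts] and tuples written carry [t.+1],
    while different rounds write tuples of different lengths. *)
Lemma warm_startP (ks : seq 'I_n) (k : nat) (ts : seq nat) (t : nat)
    (st : state) :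
  map val ks = iota k (size ks) ->
  let st' := (warm_start T ks ts t st).2 in
  [/\ ngrad st' = ngrad st, nop st' = nop st,
      points st' (rcons ts t.+1) = points st (rcons ts t.+1) &
      forall j, (j < size ks)%N ->
        points st' (ts ++ t.+1 :: nseq j.+1 0%N) =
        points st (rcons ts t ++ Tnat k :: nseq j 0%N)].
Proof.
case: ks => [//|k' ks] [k'k _] st'; rewrite -k'k Tnat_ord.
pose I (m : nat) (_ : unit) (s : state) :=
  [/\ ngrad s = ngrad st, nop s = nop st,
    (forall j, (j < m)%N -> points s (ts ++ t.+1 :: nseq j.+1 0%N) =
       points st (rcons ts t ++ T k' :: nseq j 0%N)) &
    (forall w, (forall j, w != ts ++ t.+1 :: nseq j.+1 0%N) ->
       points s w = points st w)].
have [] : I (size (k' :: ks)) tt st'.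
  rewrite /st' /warm_start.
  set f := fun j => _; have <- : (for_loop (size (k' :: ks)) f tt st).1 = tt.
    by case: (_.1).
  apply: (for_loop_ind (I := I)) => // m [] s _ [g o old oth]; split=> //=.
    move=> j; rewrite ltnS leq_eqVlt => /orP[/eqP->|jm].
      rewrite eqxx oth ?cat_rcons// => i.
      by rewrite eqseq_cat// eqxx eqseq_cons eq_sym gtn_eqF.
    rewrite old// ifF//; apply/negbTE; apply: contraTneq jm => /(congr1 size)/eqP.
    rewrite !size_cat/= !size_nseq eqn_add2l !eqSS => /eqP->.
    by rewrite ltnn.
  by move=> w wn; rewrite (negbTE (wn m)) oth.
move=> g o cp oth; split=> //; apply: oth => j.
by rewrite -cats1 eqseq_cat// eqxx eqseq_cons andbF.
Qed.

End ForLoop.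

(** * The recursion *)

Section BigOrd.
Variables (A : Type) (idx : A) (op : Monoid.com_law idx) (n : nat).
Implicit Types (F : 'I_n -> A) (k i : 'I_n).

Lemma big_ord_ltS F k :
  \big[op/idx]_(l < n | (l < k.+1)%N) F l =
  op (F k) (\big[op/idx]_(l < n | (l < k)%N) F l).
Proof.
rewrite (bigD1 k) ?ltnSn//=; congr (op _ _); apply: eq_bigl => l.
by rewrite ltnS ltn_neqAle andbC.
Qed.

Lemma big_ord_itv1 F k : \big[op/idx]_(l < n | (k <= l <= k)%N) F l = F k.
Proof.
rewrite (big_pred1 k)// => l.
by rewrite /= -val_eqE/= eqn_leq andbC.
Qed.

Lemma big_ord_itvS F k i : (k < i)%N ->
  \big[op/idx]_(l < n | (k <= l <= i)%N) F l =
  op (F k) (\big[op/idx]_(l < n | (k < l <= i)%N) F l).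
Proof.
move=> ki; rewrite (bigD1 k) ?leqnn ?(ltnW ki)//=; congr (op _ _).
apply: eq_bigl => l; rewrite [(k < l)%N]ltn_neqAle [_ == _ :> nat]eq_sym -val_eqE/=.
by case: eqVneq => _; rewrite ?andbT ?andbF.
Qed.

End BigOrd.

Section Recursion.
Variables (R : realType) (d n : nat) (C : set 'cV[R]_d) (P : 'M[R]_d).
Variables (Q : 'I_n -> 'cV[R]_d -> 'cV[R]_d) (L M : 'I_n -> R).
Variables (T : 'I_n -> nat).
Local Notation alpha := (alpha R).
Local Notation state := (state R d n).
Local Notation Rec := (Rec C P Q L M T).
Local Notation Hcoef := (Hcoef L M T).
Implicit Types (pc : 'I_n -> 'cV[R]_d -> R) (ts : seq nat) (k : 'I_n).

(** This and the next definitions name the local functions of [Rec]: [rescaled] is its [phat] and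
    [modelled] its [pnew]. *)
Definition rescaled k t (zb : 'cV[R]_d) pc (i : 'I_n) (z : 'cV[R]_d) : R :=
  if (k <= i)%N then
    (alpha t)^-1 * pc i (alpha t *: z + (1 - alpha t) *: zb)
  else pc i z.

Definition modelled k ts t (zt zb : 'cV[R]_d) pc (i : 'I_n) (z : 'cV[R]_d) : R :=
  if i == k then
    2^-1 * Hcoef k (rcons ts t) * wnorm P (z - zt) ^+ 2
    + dot z (grad (rescaled k t zb pc k) zt + Q k zt)
  else rescaled k t zb pc i z.

Definition inner_run ks k ts pc t (zb : 'cV[R]_d) (st : state) :=
  let zt := points st (rcons ts t) in
  Rec ks (rcons ts t) (modelled k ts t zt zb pc)
    (State (points st) (incr k (ngrad st)) (incr k (nop st))).

Definition corrected k ts t (zt zh : 'cV[R]_d) : 'cV[R]_d :=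
  zh + invmx (Hcoef k (rcons ts t) *: P) *m (Q k zt - Q k zh).

(** The loop body with the monadic layer unfolded. The evaluations at the start of the body are
    counted in [inner_run], the two for the correction here. *)
Definition step ks k ts pc t (zb : 'cV[R]_d) (st : state) : 'cV[R]_d * state :=
  let zt := points st (rcons ts t) in
  let r := inner_run ks k ts pc t zb st in
  (alpha t *: r.1 + (1 - alpha t) *: zb,
   (warm_start T ks ts t
     (State (fun s => if s == rcons ts t.+1 then corrected k ts t zt r.1
                      else points r.2 s)
       (ngrad r.2) (incr k (incr k (nop r.2))))).2).

Lemma Rec_cons k ks ts pc st :
  Rec (k :: ks) ts pc st =
  for_loop (T k) (step ks k ts pc) (points st (rcons ts 0%N)) st.
Proof.
rewrite /= {1}/bind {1}/read; congr (for_loop _ _ _ _).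
apply/funext => t; apply/funext => zb; apply/funext => s.
rewrite /step /inner_run /bind /read /eval_grad /eval_op /write /ret /=.
case: (Rec _ _ _ _) => zh s1 /=.
by case: (warm_start _ _ _ _ _) => -[] s2.
Qed.

Lemma Rec_cons_ind (I : nat -> 'cV[R]_d -> state -> Prop) k ks ts pc st :
  I 0%N (points st (rcons ts 0%N)) st ->
  (forall t zb s, (t < T k)%N -> I t zb s ->
     I t.+1 (step ks k ts pc t zb s).1 (step ks k ts pc t zb s).2) ->
  I (T k) (Rec (k :: ks) ts pc st).1 (Rec (k :: ks) ts pc st).2.
Proof. by move=> I0 IS; rewrite Rec_cons; apply: (for_loop_ind (I := I)). Qed.

Lemma step_state ks k ts pc t zb (s : state) :
  map val ks = iota k.+1 (size ks) ->
  let r := inner_run ks k ts pc t zb s in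
  let s' := (step ks k ts pc t zb s).2 in
  [/\ ngrad s' = ngrad r.2, nop s' = incr k (incr k (nop r.2)),
    points s' (rcons ts t.+1) = corrected k ts t (points s (rcons ts t)) r.1 &
    forall j, (j < size ks)%N -> points s' (ts ++ t.+1 :: nseq j.+1 0%N) =
      points r.2 (rcons ts t ++ Tnat T k.+1 :: nseq j 0%N)].
Proof.
move=> ksE r s'.
pose s1 := State (fun w => if w == rcons ts t.+1
    then corrected k ts t (points s (rcons ts t)) r.1 else points r.2 w)
  (ngrad r.2) (incr k (incr k (nop r.2))).
have s'E : s' = (warm_start T ks ts t s1).2 by [].
have [gE oE ptk ptj] := @warm_startP R d n T ks k.+1 ts t s1 ksE.
rewrite s'E; split=> //.
  by rewrite ptk /= eqxx.
(* The tuples copied are longer than the one just written, so the correction does not alter them. *)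
move=> j jk; rewrite ptj//= ifF//; apply/negbTE/eqP => /(congr1 size)/eqP.
by rewrite size_cat !size_rcons -[X in _ == X]addn0 eqn_add2l.
Qed.

(** * Counting the evaluations *)

Definition calls (k : nat) (i : 'I_n) : nat :=
  if (k <= i)%N then \prod_(l < n | (k <= l <= i)%N) T l else 0.

(** [calls k i] is the number of executions of the level-[i] loop body within one call at level [k];
    each body at level [k] makes one call at level [k.+1]. *)
Lemma callsE k i : calls k i = (T k * ((i == k) + calls k.+1 i))%N.
Proof.
rewrite /calls -val_eqE/=; case: (ltngtP k i) => [ki|ik|/val_inj <-].
- by rewrite add0n; exact: big_ord_itvS.
- by rewrite muln0.
- by rewrite big_ord_itv1 addn0 muln1.
Qed.

Lemma Rec_calls ks (k : nat) ts pc st i :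
  (k + size ks)%N = n -> map val ks = iota k (size ks) ->
  ngrad (Rec ks ts pc st).2 i = (ngrad st i + calls k i)%N /\
  nop (Rec ks ts pc st).2 i = (nop st i + 3 * calls k i)%N.
Proof.
elim: ks k ts pc st => [|k0 ks IH] k ts pc st.
  rewrite addn0 => -> _; rewrite /calls leqNgt ltn_ord/= muln0 !addn0.
  by [].
move=> kn [k0k ksE]; subst k; rewrite callsE.
set c := (_ + calls _ _)%N.
pose I (t : nat) (_ : 'cV[R]_d) (s : state) :=
  ngrad s i = (ngrad st i + t * c)%N /\ nop s i = (nop st i + 3 * (t * c))%N.
apply: (Rec_cons_ind (I := I)) => [|t zb s tT [gE oE]].
  by rewrite /I mul0n muln0 !addn0.
have [sg so _ _] := step_state ts pc t zb s ksE.
rewrite /I sg so /inner_run /incr.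
have [|-> ->] := IH k0.+1 (rcons ts t)
  (modelled k0 ts t (points s (rcons ts t)) zb pc)
  (State (points s) (incr k0 (ngrad s)) (incr k0 (nop s))) _ ksE.
  by rewrite addSnnS.
by rewrite /= /incr gE oE mulSn /c; split; lia.
Qed.

(** * Rescaled constants and error weights *)

Definition last_alpha (l : 'I_n) : R := alpha (T l).-1.

(** [Lprod] and [Mprod] are the factors that the constants [L i] and [M i] have acquired after the
    first [k] levels. *)
Definition Lprod (k : nat) ts : R := \prod_(l < n | (l < k)%N) alpha (nth 0%N ts l).

Definition Mprod (k : nat) ts : R :=
  \prod_(l < n | (l < k)%N) (alpha (nth 0%N ts l) / last_alpha l).

Definition Wprod (k : nat) (i : 'I_n) : R :=
  \prod_(l < n | (k <= l <= i)%N) last_alpha l.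

(* The weight, in the error bound of the call at level [k], of the squared
   distance to the point of level [i]. *)
Definition Ecoef (k : nat) ts i : R :=
  L i * Lprod k ts * Wprod k i ^+ 2 + M i * Mprod k ts * Wprod k i.

Lemma Lprod_gt0 (k : nat) ts : 0 < Lprod k ts.
Proof. by rewrite prodr_gt0// => l _; exact: alpha_gt0. Qed.

Lemma Mprod_gt0 (k : nat) ts : 0 < Mprod k ts.
Proof. by rewrite prodr_gt0// => l _; rewrite divr_gt0 ?alpha_gt0. Qed.

Lemma eq_prefix_prod (F : 'I_n -> nat -> R) (k : nat) ts t : (k <= size ts)%N ->
  \prod_(l < n | (l < k)%N) F l (nth 0%N (rcons ts t) l) =
  \prod_(l < n | (l < k)%N) F l (nth 0%N ts l).
Proof.
move=> kts; apply: eq_bigr => l lk.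
by rewrite nth_rcons (leq_trans lk kts).
Qed.

Lemma Lprod_rcons k ts t : size ts = k ->
  Lprod k.+1 (rcons ts t) = Lprod k ts * alpha t.
Proof.
move=> sk; rewrite /Lprod big_ord_ltS (eq_prefix_prod (fun _ s => alpha s)) ?sk//.
by rewrite nth_rcons sk ltnn eqxx [LHS]mulrC.
Qed.

Lemma Mprod_rcons k ts t : size ts = k ->
  Mprod k.+1 (rcons ts t) = Mprod k ts * (alpha t / last_alpha k).
Proof.
move=> sk; rewrite /Mprod big_ord_ltS.
rewrite (eq_prefix_prod (fun l s => alpha s / last_alpha l)) ?sk//.
by rewrite nth_rcons sk ltnn eqxx [LHS]mulrC.
Qed.

Lemma Wprod_id k : Wprod k k = last_alpha k.
Proof. exact: big_ord_itv1. Qed.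

Lemma WprodS k (i : 'I_n) : (k < i)%N ->
  Wprod k i = last_alpha k * Wprod k.+1 i.
Proof. exact: big_ord_itvS. Qed.

Lemma HcoefE k ts t : size ts = k -> Hcoef k (rcons ts t) =
  L k * (Lprod k ts * alpha t) + M k * (Mprod k ts * (alpha t / last_alpha k)).
Proof. by move=> sk; rewrite -Lprod_rcons// -Mprod_rcons. Qed.

Lemma Hcoef_rcons k ts t : (k < size ts)%N -> Hcoef k (rcons ts t) = Hcoef k ts.
Proof.
move=> ks; rewrite /Hcoef; congr (_ * _ + _ * _).
  exact: (eq_prefix_prod (fun _ s => alpha s) (k := k.+1)).
exact: (eq_prefix_prod (fun l s => alpha s / last_alpha l) (k := k.+1)).
Qed.

(** The right-hand side is independent of [t]: this is what lets the inner errors telescope over the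
    loop. [Ecoef_self] is the counterpart for the level's own term. *)
Lemma Ecoef_step k ts t (i : 'I_n) : size ts = k -> (k < i)%N ->
  (alpha t)^-1 * Ecoef k.+1 (rcons ts t) i = Ecoef k ts i / last_alpha k ^+ 2.
Proof.
move=> sk ki; rewrite /Ecoef Lprod_rcons// Mprod_rcons// WprodS//.
by field; rewrite !gt_eqF ?alpha_gt0.
Qed.

Lemma Ecoef_self k ts t : size ts = k ->
  (alpha t)^-1 * Hcoef k (rcons ts t) = Ecoef k ts k / last_alpha k ^+ 2.
Proof.
move=> sk; rewrite HcoefE// /Ecoef Wprod_id.
by field; rewrite !gt_eqF ?alpha_gt0.
Qed.

Hypotheses (L0 : forall i, 0 <= L i) (M0 : forall i, 0 <= M i).
Hypothesis LM0 : forall i, 0 < L i + M i.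

Lemma Hcoef_gt0 k ts : 0 < Hcoef k ts.
Proof.
rewrite -[Hcoef k ts]/(L k * Lprod k.+1 ts + M k * Mprod k.+1 ts).
have [Lk|Lk] := eqVneq (L k) 0.
  have := LM0 k; rewrite Lk mul0r !add0r => Mk.
  by rewrite mulr_gt0// Mprod_gt0.
have {}Lk : 0 < L k by rewrite lt_neqAle eq_sym Lk L0.
by rewrite ltr_wpDr ?mulr_gt0 ?Lprod_gt0// mulr_ge0// ltW// Mprod_gt0.
Qed.

(** Step sizes decrease, so each is at least the last one of its loop. The rescaled operator
    constant thus never drops below [M i], as the extragradient step demands. *)
Lemma Mprod_ge1 (k : nat) ts :
  (forall l : 'I_n, (l < k)%N -> (nth 0%N ts l < T l)%N) -> 1 <= Mprod k ts.
Proof.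
move=> tsT; rewrite /Mprod; elim/big_ind: _ => // [x y x1 y1|l lk].
  by rewrite mulr_ege1.
rewrite ler_pdivlMr ?alpha_gt0// mul1r alpha_le//.
by have := tsT l lk; case: (T l).
Qed.

Hypotheses (Psym : P^T = P) (Ppos : posdef P).
Hypotheses (C0 : C !=set0) (clC : closed C) (cvC : convex_set C).
Hypothesis Qmono : forall i, monotone_op (Q i).
Hypothesis Qlip : forall i, lipschitz_op P (M i) (Q i).
Hypothesis n0 : (0 < n)%N.
Hypothesis T0 : forall i, (0 < T i)%N.

(** * The gap and its bound by induction on the levels *)

Local Notation N z := (wnorm P z ^+ 2).

(** Invariant of the functions passed down: levels before [k] are already quadratic models, the
    others are rescaled originals. *)
Definition admissible (k : nat) ts pc :=
  (forall i : 'I_n, (i < k)%N -> quadratic P (Hcoef i ts) (pc i)) /\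
  (forall i : 'I_n, (k <= i)%N -> convex_smooth P (L i * Lprod k ts) (pc i)).

(** At level 0 only the operator form occurs, giving the quantity to be bounded; at level [n] only
    the quadratic form occurs. *)
Definition gap_term (k : nat) ts pc (z u : 'cV[R]_d) (i : 'I_n) : R :=
  pc i u - pc i z +
  (if (i < k)%N then Hcoef i ts / 2 * N (u - z) else dot (Q i z) (u - z)).

Definition gap (k : nat) ts pc (z u : 'cV[R]_d) : R :=
  \sum_(i < n) gap_term k ts pc z u i.

Lemma rescaled_convex_smooth k ts t zb pc (i : 'I_n) : size ts = k ->
  (k <= i)%N -> admissible k ts pc ->
  convex_smooth P (L i * Lprod k ts * alpha t) (rescaled k t zb pc i).
Proof.
move=> sk ki [_ /(_ _ ki) pcK]; rewrite /rescaled ki.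
by apply: convex_smooth_rescale => //; exact: alpha_gt0.
Qed.

Lemma admissible_step k ts t zt zb pc : size ts = k ->
  admissible k ts pc -> admissible k.+1 (rcons ts t) (modelled k ts t zt zb pc).
Proof.
move=> sk adm; split=> i; rewrite /modelled -val_eqE/=.
  rewrite ltnS leq_eqVlt; case: eqVneq => [/val_inj -> _|_ /= ik].
    exact: quadratic_model.
  rewrite Hcoef_rcons ?sk//.
  have -> : rescaled k t zb pc i = pc i.
    by apply/funext => z; rewrite /rescaled leqNgt ik.
  by case: adm => + _; exact.
move=> ki; rewrite gtn_eqF// Lprod_rcons// mulrA.
by apply: rescaled_convex_smooth => //; exact: ltnW.
Qed.

Lemma gap_step k ts t zt zb zh pc z : size ts = k ->
  (forall l : 'I_n, (l < k)%N -> (nth 0%N ts l < T l)%N) -> (t < T k)%N ->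
  admissible k ts pc ->
  gap k ts pc z (alpha t *: zh + (1 - alpha t) *: zb) <=
  (1 - alpha t) * gap k ts pc z zb +
  alpha t * (gap k.+1 (rcons ts t) (modelled k ts t zt zb pc) z zh +
    Hcoef k (rcons ts t) / 2 *
      (N (zt - z) - N (corrected k ts t zt zh - z))).
Proof.
move=> sk tsT tT adm.
have a0 := alpha_gt0 R t; have a1 := alpha_le1 R t.
set X := _ / 2 * (_ - _).
(* Charging the telescoping difference to index [k] lets the inequality be proved term by term. *)
have -> : X = \sum_(i < n) (if i == k then X else 0).
  by rewrite -big_mkcond/= big_pred1_eq.
rewrite /gap -big_split/= !mulr_sumr -big_split/=.
apply: ler_sum => i _; rewrite /gap_term /modelled.
have [ik|ik|/val_inj ik] := ltngtP i k.
- have -> : (i == k) = false by rewrite -val_eqE/= ltn_eqF.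
  rewrite ltnS (ltnW ik) Hcoef_rcons ?sk// addr0 /rescaled leqNgt ik/=.
  apply: quadratic_step => //; first by rewrite a1 ltW.
    by rewrite ltW// Hcoef_gt0.
  by case: adm => + _; exact.
- have -> : (i == k) = false by rewrite -val_eqE/= gtn_eqF.
  rewrite ltnNge ik/= addr0 /rescaled (ltnW ik).
  case: adm => _ /(_ i (ltnW ik)) pcK.
  by apply: rescale_step pcK; rewrite a0.
- rewrite ik eqxx ltnS leqnn.
  case: (adm) => _ /(_ k (leqnn k)) pcK.
  have a01 : 0 < alpha t <= 1 by rewrite a0.
  apply: (le_trans (rescale_step (Q k z) zh zb z a01 pcK)).
  rewrite lerD2l ler_pM2l//.
  have rK := rescaled_convex_smooth t zb sk (leqnn k) adm.
  have rE u : (alpha t)^-1 * pc k (alpha t *: u + (1 - alpha t) *: zb) =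
    rescaled k t zb pc k u by rewrite /rescaled leqnn.
  rewrite !rE.
  have H0 := Hcoef_gt0 k (rcons ts t).
  (* Without its smoothness part, [Hcoef] is [M k] times a factor that is at least 1. *)
  have MH : M k <= Hcoef k (rcons ts t) - L k * Lprod k ts * alpha t.
    rewrite HcoefE// mulrA addrAC subrr add0r -Mprod_rcons// ler_peMr//.
    apply: Mprod_ge1 => l; rewrite ltnS leq_eqVlt => /orP[/eqP lk|lk].
      by rewrite lk nth_rcons sk ltnn eqxx (val_inj lk : l = k).
    by rewrite nth_rcons sk lk tsT.
  have MH' : M k <= Hcoef k (rcons ts t).
    apply: (le_trans MH); rewrite gerBl// !mulr_ge0// ltW//.
    exact: Lprod_gt0.
  exact: (@extragradient_step _ _ _ Psym Ppos _ _ _ _ _ zt zh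
    (corrected k ts t zt zh) z rK (Qmono k) (Qlip k) (M0 k) MH MH' H0 erefl).
Qed.

(** A level-[i] point has a tuple of length [i.+1], so [ts], of length [k], is completed by
    [i - k + 1] entries: all zero at the start, [T k] followed by zeros at the end. *)
Definition error_bound (k : nat) ts (st st' : state) (z : 'cV[R]_d) : R :=
  2^-1 * \sum_(i < n | (k <= i)%N) Ecoef k ts i *
    (N (points st (ts ++ nseq (i - k).+1 0%N) - z) -
     N (points st' (ts ++ Tnat T k :: nseq (i - k) 0%N) - z)).

Lemma convex_set_comb (a : R) (x y : 'cV[R]_d) :
  0 <= a -> a <= 1 -> C x -> C y -> C (a *: x + (1 - a) *: y).
Proof.
move=> a0 a1 Cx Cy.
by have := cvC (Itv01 a0 a1) (mem_set Cx) (mem_set Cy); rewrite inE.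
Qed.

Lemma Rec_gap ks (k : nat) ts pc st :
  (k + size ks)%N = n -> map val ks = iota k (size ks) -> size ts = k ->
  (forall l : 'I_n, (l < k)%N -> (nth 0%N ts l < T l)%N) ->
  admissible k ts pc ->
  C (Rec ks ts pc st).1 /\
  forall z, C z ->
    gap k ts pc z (Rec ks ts pc st).1 <= error_bound k ts st (Rec ks ts pc st).2 z.
Proof.
elim: ks k ts pc st => [|k0 ks IH] k ts pc st.
  rewrite addn0 => -> _ sk tsT [pcq _].
  (* Every level is quadratic here: strong convexity at the minimizer says that the gap is
     nonpositive, and the error bound is an empty sum. *)
  have {pcq}qs := quadratic_sum (fun i => pcq i (ltn_ord i)).
  have Hs : 0 < \sum_(i < n) Hcoef i ts.
    rewrite (bigD1 (Ordinal n0))//= ltr_pwDl ?Hcoef_gt0//.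
    by rewrite sumr_ge0// => i _; rewrite ltW// Hcoef_gt0.
  have [Cu umin] := quadratic_argmin Psym Ppos Hs qs C0 clC cvC.
  split=> // z Cz; rewrite /error_bound big_pred0; last first.
    by move=> i; rewrite leqNgt ltn_ord.
  rewrite mulr0 /gap /=; set u := argmin _ _.
  under eq_bigr => i _ do rewrite /gap_term ltn_ord.
  rewrite big_split/= sumrB -!mulr_suml.
  by have := umin z Cz; rewrite -/u; lra.
move=> kn [k0k ksE] sk tsT adm; subst k.
pose G i := Ecoef k0 ts i / last_alpha k0 ^+ 2.
(* The prefactor vanishes at [t = 0], as [alpha 0 = 1], and membership is asked only for [0 < t]:
   the initial average may lie outside [C]. *)
pose I (t : nat) (zb : 'cV[R]_d) (s : state) :=
  ((0 < t)%N -> C zb) /\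
  forall z, C z -> (1 - alpha t) / alpha t ^+ 2 * gap k0 ts pc z zb <=
    2^-1 * \sum_(i < n | (k0 <= i)%N) G i *
    (N (points st (ts ++ nseq (i - k0).+1 0%N) - z) -
     N (points s (ts ++ t :: nseq (i - k0) 0%N) - z)).
have [] : I (T k0) (Rec (k0 :: ks) ts pc st).1 (Rec (k0 :: ks) ts pc st).2.
  apply: Rec_cons_ind.
    split=> // z Cz; rewrite subrr mul0r mul0r big1 ?mulr0// => i _.
    by rewrite subrr mulr0.
  move=> t zb s tT [Czb zbP].
  have [_ _ ptk ptj] := step_state ts pc t zb s ksE.
  set r := inner_run _ _ _ _ _ _ _ in ptk ptj; rewrite [(step _ _ _ _ _ _ _).1]/=.
  set s' := (step _ _ _ _ _ _ _).2 in ptk ptj *.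
  set zt := points s (rcons ts t) in ptk.
  have [||||| Cr rP] := IH k0.+1 (rcons ts t) (modelled k0 ts t zt zb pc)
    (State (points s) (incr k0 (ngrad s)) (incr k0 (nop s))).
  - by rewrite addSnnS.
  - by rewrite ksE.
  - by rewrite size_rcons sk.
  - move=> l; rewrite ltnS leq_eqVlt nth_rcons sk => /orP[/eqP lk|lk].
      by rewrite lk ltnn eqxx (val_inj lk : l = k0).
    by rewrite lk tsT.
  - exact: admissible_step.
  rewrite -/(inner_run ks k0 ts pc t zb s) -/r in Cr rP.
  have a0 := alpha_gt0 R t.
  split=> [_|z Cz].
    have [t0|t0] := posnP t.
      have -> : alpha t = 1 by rewrite t0.
      by rewrite subrr scale0r addr0 scale1r.
    exact: convex_set_comb (ltW a0) (alpha_le1 R t) Cr (Czb t0).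
  have gz := gap_step zt zb r.1 z sk tsT tT adm.
  have rz := rP z Cz; have zbz := zbP z Cz.
  pose B (i : 'I_n) := N (points s (ts ++ t :: nseq (i - k0) 0%N) - z).
  pose B' (i : 'I_n) := N (points s' (ts ++ t.+1 :: nseq (i - k0) 0%N) - z).
  (* Divided by [alpha t], the inner bound has the weights [G]; the correction and the warm start
     identify its end points with the start points of round [t.+1]. *)
  have key : (alpha t)^-1 * (error_bound k0.+1 (rcons ts t) s r.2 z +
      Hcoef k0 (rcons ts t) / 2 * (N (zt - z) - N (corrected k0 ts t zt r.1 - z)))
      = 2^-1 * \sum_(i < n | (k0 <= i)%N) G i * (B i - B' i).
    rewrite [in RHS](bigD1 k0)//= [LHS]mulrDr [RHS]mulrDr [LHS]addrC; congr (_ + _).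
      rewrite /G -(Ecoef_self t sk) /B /B' subnn -ptk /zt !cats1.
      by rewrite -!mulrA (mulrCA 2^-1); ring.
    rewrite /error_bound mulrCA; congr (_ * _); rewrite mulr_sumr.
    apply: eq_big => [i|i ki]; first by rewrite ltn_neqAle andbC eq_sym.
    rewrite mulrA (Ecoef_step t sk ki) -/(G i) /B /B' -(subnSK ki) ptj ?cat_rcons//.
    by rewrite -(ltn_add2l k0.+1) subnKC// -addSnnS in kn *; rewrite kn.
  have -> : \sum_(i < n | (k0 <= i)%N) G i *
      (N (points st (ts ++ nseq (i - k0).+1 0%N) - z) - B' i) =
    \sum_(i < n | (k0 <= i)%N) G i *
      (N (points st (ts ++ nseq (i - k0).+1 0%N) - z) - B i) +
    \sum_(i < n | (k0 <= i)%N) G i * (B i - B' i).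
    by rewrite -big_split; apply: eq_bigr => i _ /=; ring.
  rewrite alphaS_rec mulrDr -key; apply: le_trans (lerD zbz (lexx _)).
  have h : (alpha t)^-1 ^+ 2 * gap k0 ts pc z (alpha t *: r.1 + (1 - alpha t) *: zb)
    <= (alpha t)^-1 ^+ 2 * _ := ler_wpM2l (sqr_ge0 _) gz.
  apply: (le_trans h); rewrite mulrDr; apply: lerD.
    by rewrite exprVn mulrA [X in X * _]mulrC.
  have -> u : (alpha t)^-1 ^+ 2 * (alpha t * u) = (alpha t)^-1 * u.
    by field; rewrite gt_eqF.
  by rewrite ler_pM2l ?invr_gt0// lerD2r.
rewrite T0 => /(_ isT) Cu uP; split=> // z Cz.
(* After the last round the prefactor is [1 / last_alpha k0 ^ 2], which is cleared. *)
have := uP z Cz; rewrite -(prednK (T0 k0)) alphaS_rec prednK//.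
rewrite -/(last_alpha k0) /error_bound Tnat_ord.
have a0 : 0 < last_alpha k0 by exact: alpha_gt0.
rewrite -(ler_pM2l (_ : 0 < last_alpha k0 ^+ 2)) ?exprn_gt0// exprVn.
rewrite mulVKf; last first.
  by rewrite expf_neq0// gt_eqF.
move/le_trans; apply; rewrite mulrCA ler_wpM2l ?invr_ge0//.
rewrite mulr_sumr; apply: ler_sum => i _; rewrite mulrA.
by rewrite (_ : _ * G i = Ecoef k0 ts i) ?lexx// /G; field; rewrite gt_eqF.
Qed.

(** At the outermost call the prefix products are empty, all starting points equal [zin], and the
    final squared distances are dropped. *)
Lemma algorithm1_spec (p : 'I_n -> 'cV[R]_d -> R) zin :
  (forall i, convex_smooth P (L i) (p i)) ->
  let run := algorithm1 C P p Q L M T zin in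
  [/\ C run.1,
    forall z, C z ->
      \sum_(i < n) p i run.1 - \sum_(i < n) p i z
      + dot (\sum_(i < n) Q i z) (run.1 - z) <=
      2^-1 * (\sum_(i < n) (L i * Wprod 0 i ^+ 2 + M i * Wprod 0 i)) * N (zin - z),
    forall i, ngrad run.2 i = (\prod_(l < n | (l <= i)%N) T l)%N &
    forall i, nop run.2 i = (3 * \prod_(l < n | (l <= i)%N) T l)%N].
Proof.
move=> pK run.
have size_n : (0 + size (enum 'I_n))%N = n by rewrite add0n size_enum_ord.
have enumE : map val (enum 'I_n) = iota 0 (size (enum 'I_n)).
  by rewrite val_enum_ord size_enum_ord.
have adm : admissible 0 [::] p.
  by split=> // i _; rewrite /Lprod big_pred0 ?mulr1.
have [//|Cu gapu] := @Rec_gap (enum 'I_n) 0 [::] p (init_state n zin)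
  size_n enumE erefl _ adm.
have callsu i := @Rec_calls (enum 'I_n) 0 [::] p (init_state n zin) i
  size_n enumE.
split=> [//|z Cz|i|i]; last 2 first.
- by have [-> _] := callsu i.
- by have [_ ->] := callsu i.
have := gapu z Cz; rewrite -/(algorithm1 C P p Q L M T zin) -/run /gap /gap_term.
rewrite big_split/= sumrB dot_suml => /le_trans; apply.
rewrite /error_bound -[leRHS]mulrA ler_wpM2l ?invr_ge0// mulr_suml.
apply: ler_sum => i _.
rewrite /Ecoef /Lprod /Mprod !big_pred0// !mulr1 ler_wpM2l//.
  have W0 : 0 < Wprod 0 i by rewrite prodr_gt0// => l _; exact: alpha_gt0.
  by apply: addr_ge0; rewrite mulr_ge0 ?exprn_ge0 ?(ltW W0).
by rewrite /= all_nseq orbT lerBlDr lerDl sqr_ge0.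
Qed.

End Recursion.

(** * Ordering and lengths *)

Lemma sorting_perm (R : realType) (n : nat) (kappa : 'I_n -> R) :
  exists s : 'S_n, forall i j : 'I_n, (i <= j)%N -> kappa (s i) <= kappa (s j).
Proof.
pose leK : rel 'I_n := relpre kappa <=%O.
have leK_tr : transitive leK by move=> y x z; exact: le_trans.
have leK_tot : total leK by move=> x y; exact: le_total.
pose t := sort leK (enum 'I_n).
have size_t : size t = n by rewrite size_sort size_enum_ord.
have uniq_t : uniq t by rewrite sort_uniq enum_uniq.
have f_inj : injective (fun i : 'I_n => nth i t i).
  move=> i j; rewrite (set_nth_default j i) ?size_t// => /eqP.
  by rewrite nth_uniq ?size_t// => /eqP/val_inj.
exists (perm f_inj) => i j ij; rewrite !permE (set_nth_default i j) ?size_t//.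
apply: (sorted_leq_nth leK_tr _ i (sort_sorted leK_tot _)) => //.
- by move=> x; exact: lexx.
- by rewrite inE -/t size_t.
- by rewrite inE -/t size_t.
Qed.

(** Take the least positive [t] satisfying the lower bound; unless [t = 1], its predecessor
    fails. *)
Lemma exists_length (R : realType) (S x : R) : 0 < S ->
  exists t : nat, [/\ (0 < t)%N, x <= S * (t.+1%:R / 2) &
    t = 1%N \/ S * (t%:R / 2) <= x].
Proof.
move=> S0; pose large t := (0 < t)%N && (x <= S * (t.+1%:R / 2)).
have exL : exists t, large t.
  exists (Num.truncn (`|x| / S * 2)).+1; rewrite /large/=.
  have := truncnS_gt (`|x| / S * 2); set m := Num.truncn _ => xm.
  apply: (le_trans (ler_norm x)).
  rewrite -[`|x|](divfK (lt0r_neq0 S0)) mulrC ler_pM2l//.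
  by rewrite -[m.+2%:R]natr1; lra.
have [t /andP[t0 xt] tmin] := ex_minnP exL; exists t; split=> //.
case: t t0 xt tmin => [//|[|t]] _ _ tmin; first by left.
right; rewrite leNgt; apply/negP => h.
by have := tmin t.+1; rewrite /large/= ltW// => /(_ isT); rewrite ltnn.
Qed.

(** Lengths are chosen one after another. A new length 1 leaves the product unchanged and
    monotonicity of [kappa] carries the bound over; otherwise minimality bounds the new factor. *)
Lemma exists_lengths (R : realType) (kappa : nat -> R) (m : nat) :
  (forall i, (i < m)%N -> 1 <= kappa i) ->
  (forall i j, (i <= j < m)%N -> kappa i <= kappa j) ->
  exists T : nat -> nat, forall i, (i < m)%N ->
    [/\ (0 < T i)%N, kappa i <= \prod_(l < i.+1) ((T l).+1%:R / 2) &
      \prod_(l < i.+1) (T l)%:R <= 2 ^+ i.+1 * kappa i].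
Proof.
elim: m => [|m IH] k1 kmono; first by exists (fun=> 1%N).
have [||T TP] := IH.
- by move=> i im; apply: k1; rewrite ltnW.
- by move=> i j /andP[ij jm]; apply: kmono; rewrite ij ltnW.
pose S : R := \prod_(l < m) ((T l).+1%:R / 2).
have S0 : 0 < S by rewrite prodr_gt0// => l _; rewrite divr_gt0.
have [t [t0 xt tS]] := exists_length (kappa m) S0.
pose T' l := if (l < m)%N then T l else t.
have prodT' (F : nat -> R) i : (i <= m)%N ->
    \prod_(l < i) F (T' l) = \prod_(l < i) F (T l).
  move=> im; apply: eq_bigr => l _.
  by rewrite /T' (leq_trans (ltn_ord l) im).
have T'm : T' m = t by rewrite /T' ltnn.
have le_NS : \prod_(l < m) (T l)%:R <= 2 ^+ m * S.
  rewrite /S -[X in 2 ^+ X]card_ord -prodr_const -big_split/=.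
  apply: ler_prod => l _; rewrite ler0n/= mulrC divfK//.
  by rewrite ler_nat.
have le_Nk : \prod_(l < m) (T l)%:R <= 2 ^+ m * kappa m.
  case: m k1 kmono TP {IH S S0 xt tS T' prodT' T'm le_NS} => [|m] k1 kmono TP.
    by rewrite big_ord0 mul1r k1.
  have [_ _ /le_trans] := TP m (leqnn _); apply.
  by rewrite ler_wpM2l ?exprn_ge0// kmono// leqnSn ltnS leqnn.
exists T' => i; rewrite ltnS leq_eqVlt => /orP[/eqP->|im]; last first.
  rewrite !(prodT' (fun l => l.+1%:R / 2))// !(prodT' (fun l => l%:R))//.
  by rewrite /T' im; exact: TP.
rewrite !big_ord_recr/= (prodT' (fun l => l.+1%:R / 2))//.
rewrite (prodT' (fun l => l%:R))// T'm; split=> //.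
case: tS => [->|tk].
  rewrite mulr1; apply: (le_trans le_Nk).
  have := k1 m (leqnn _); rewrite exprS => km.
  have : 0 <= 2 ^+ m * kappa m by rewrite mulr_ge0 ?exprn_ge0//; lra.
  lra.
apply: (@le_trans _ _ (2 ^+ m * S * t%:R)); first by rewrite ler_wpM2r.
rewrite exprSr -!mulrA ler_wpM2l ?exprn_ge0//.
lra.
Qed.

(** Each factor is at most 1, since [alpha (T - 1) <= 2 / (T + 1)]. *)
Lemma Wprod_le (R : realType) (n : nat) (T : 'I_n -> nat) (i : 'I_n) :
  (forall l, (0 < T l)%N) ->
  Wprod R T 0 i * \prod_(l < n | (l <= i)%N) ((T l).+1%:R / 2) <= 1.
Proof.
move=> T0; rewrite /Wprod -big_split/=; apply: prodr_ile1 => l _.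
have a0 := alpha_gt0 R (T l).-1.
rewrite /last_alpha mulr_ge0 ?divr_ge0 ?(ltW a0)//=.
rewrite -[leRHS](divff (lt0r_neq0 a0)) ler_pM2l//.
have := alpha_inv_ge R (T l).-1; have := T0 l; case: (T l) => //= t _.
by rewrite -[t.+2%:R]natr1 -[t.+1%:R]natr1; lra.
Qed.

(** * Choice of order and lengths, and the final estimates *)

Theorem corollary1 (R : realType) (d n : nat) (C : set 'cV[R]_d) (P : 'M[R]_d)
    (p : 'I_n -> 'cV[R]_d -> R) (Q : 'I_n -> 'cV[R]_d -> 'cV[R]_d)
    (L M : 'I_n -> R) :
  (1 <= n)%N ->
  C !=set0 -> closed C -> convex_set C ->
  P^T = P -> posdef P ->
  (forall i z, differentiable (p i) z) ->
  (forall i, 0 <= L i) -> (forall i, 0 <= M i) -> (forall i, 0 < L i + M i) ->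
  (forall i, monotone_op (grad (p i)) /\ lipschitz_op P (L i) (grad (p i))) ->
  (forall i, monotone_op (Q i) /\ lipschitz_op P (M i) (Q i)) ->
  forall eps : R, 0 < eps ->
  exists (s : 'S_n) (T : 'I_n -> nat),
    (forall i, (0 < T i)%N) /\
    forall zin, C zin ->
      let run := algorithm1 C P (fun i => p (s i)) (fun i => Q (s i))
                   (fun i => L (s i)) (fun i => M (s i)) T zin in
      let zout := run.1 in
      [/\ C zout,
          forall z, C z ->
            \sum_(i < n) p i zout - \sum_(i < n) p i z
              + dot (\sum_(i < n) Q i z) (zout - z)
            <= eps * n%:R * wnorm P (zin - z) ^+ 2
        & forall i : 'I_n,
            let bound := 6 ^+ n *
              Num.max (Num.max (Num.sqrt (L (s i) / eps)) (M (s i) / eps)) 1 in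
            (ngrad run.2 i)%:R <= bound /\ (nop run.2 i)%:R <= bound].

Proof.
move=> n0 C0 clC cvC Psym Ppos pdiff L0 M0 LM0 pG QG eps eps0.
pose kappa i := Num.max (Num.max (Num.sqrt (L i / eps)) (M i / eps)) 1.
have [s smono] := sorting_perm kappa.
(* The sorted thresholds as a sequence; the default 1 concerns only indices beyond the last
   level. *)
pose kn (i : nat) := oapp (fun j : 'I_n => kappa (s j)) 1 (insub i).
have knE (i : 'I_n) : kn i = kappa (s i) by rewrite /kn valK.
have kappa1 i : 1 <= kappa i by rewrite le_max lexx orbT.
have [||T TP] := @exists_lengths R kn n.
- by move=> i ii; rewrite -[i]/(val (Ordinal ii)) knE.
- move=> i j /andP[ij jn]; have ii := leq_ltn_trans ij jn.
  rewrite -[i]/(val (Ordinal ii)) -[j]/(val (Ordinal jn)) !knE.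
  exact: smono.
pose T' (i : 'I_n) := T i.
have T0 i : (0 < T' i)%N by have [] := TP i (ltn_ord i).
exists s, T'; split=> // zin _ run zout.
have pK i : convex_smooth P (L (s i)) (p (s i)).
  by have [mono lip] := pG (s i); apply: lipschitz_convex_smooth.
have [Cu gapu gradE opE] := algorithm1_spec (fun i => L0 (s i))
  (fun i => M0 (s i)) (fun i => LM0 (s i)) Psym Ppos C0 clC cvC
  (fun i => proj1 (QG (s i))) (fun i => proj2 (QG (s i))) n0 T0 zin pK.
have prodE (F : nat -> R) (i : 'I_n) :
    \prod_(l < i.+1) F l = \prod_(l < n | (l <= i)%N) F l.
  by rewrite (big_ord_widen n F (ltn_ord i)).
have Wk i : Wprod R T' 0 i * kappa (s i) <= 1.
  apply: le_trans (Wprod_le R i T0); rewrite ler_wpM2l//.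
    by rewrite ltW// prodr_gt0// => l _; exact: alpha_gt0.
  have [_ + _] := TP i (ltn_ord i).
  by rewrite knE (prodE (fun l => (T l).+1%:R / 2)).
split=> //.
- move=> z Cz; have := gapu z Cz.
  rewrite -[algorithm1 _ _ _ _ _ _ _ _]/run -/zout => h.
  have -> : \sum_(i < n) p i zout = \sum_(i < n) p (s i) zout.
    exact: (reindex_inj (@perm_inj _ s)).
  have -> : \sum_(i < n) p i z = \sum_(i < n) p (s i) z.
    exact: (reindex_inj (@perm_inj _ s)).
  have -> : \sum_(i < n) Q i z = \sum_(i < n) Q (s i) z.
    exact: (reindex_inj (@perm_inj _ s)).
  apply: (le_trans h); rewrite ler_wpM2r ?sqr_ge0//.
  rewrite ler_pdivrMl//.
  (* Each level gets a budget [2 eps]: one [eps] for its gradient part, by [L / eps <= kappa ^ 2],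
     and one for its operator part, by [M / eps <= kappa], both with [W * kappa <= 1]. *)
  have -> : 2 * (eps * n%:R) = \sum_(i < n) (eps + eps).
    by rewrite sumr_const card_ord -mulr_natr; ring.
  apply: ler_sum => i _.
  have := Wk i; have : 0 < Wprod R T' 0 i.
    by rewrite prodr_gt0// => l _; exact: alpha_gt0.
  have : Num.sqrt (L (s i) / eps) <= kappa (s i) by rewrite !le_max lexx.
  have : M (s i) / eps <= kappa (s i) by rewrite !le_max lexx orbT.
  move: (kappa _) (kappa1 (s i)) (Wprod _ _ _ _) => k k1 w Mk Lk w0 wk.
  have k0 : 0 < k by lra.
  have wk2 : (w * k) ^+ 2 <= 1 by rewrite expr_le1// mulr_ge0// ltW.
  apply: lerD.
    have : L (s i) / eps <= k ^+ 2.
      rewrite -[leLHS]sqr_sqrtr ?divr_ge0 ?(ltW eps0)//.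
      by rewrite lerXn2r// nnegrE ?sqrtr_ge0 ?(ltW k0).
    rewrite ler_pdivrMr// => /(ler_wpM2r (sqr_ge0 w)) /le_trans; apply.
    rewrite mulrAC -exprMn (mulrC k) -[leRHS]mul1r.
    by rewrite ler_wpM2r// ltW.
  move: Mk; rewrite ler_pdivrMr// => /(ler_wpM2r (ltW w0)) /le_trans; apply.
  by rewrite mulrAC (mulrC k) -[leRHS]mul1r ler_wpM2r// ltW.
- move=> i bound.
  have boundE : bound = 6 ^+ n * kappa (s i) by [].
  have le_prod : (\prod_(l < n | (l <= i)%N) T' l)%:R <= 2 ^+ n * kappa (s i).
    rewrite natr_prod; have [_ _] := TP i (ltn_ord i).
    rewrite knE (prodE (fun l => (T l)%:R)) => /le_trans; apply.
    rewrite ler_wpM2r ?(le_trans ler01)// ler_weXn2l ?ler1n//.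
  (* The three operator evaluations per iteration are absorbed by [3 <= 3 ^ n], valid as
     [n >= 1]. *)
  have le3 : (3 : R) * (2 ^+ n * kappa (s i)) <= bound.
    rewrite boundE mulrA ler_wpM2r ?(le_trans ler01)//.
    rewrite (_ : 6 = 3 * 2) ?exprMn; last by rewrite -natrM.
    by rewrite ler_wpM2r ?exprn_ge0// -[leLHS]expr1 ler_weXn2l ?ler1n.
  rewrite /run gradE opE natrM; split.
    by have := ler0n R (\prod_(l < n | (l <= i)%N) T' l); lra.
  lra.
Qed.
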